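(* Consider step $n$ of the regularized iteration $$\left\{ \alpha^n R + \gamma_{10}A_1'(u^n;u^n) + \gamma_{01}A_2'(u^n)\right\}\mathtt{w}^n = \delta f_Q - A(u^n;u^n), \qquad u^{n+1}=u^n+w^n,$$ applied to the discrete problem $A(u;u)=f_Q$ (all objects as defined in the context), where $\gamma_{10}\ge 1$, the linear system is solved up to the floating-point error vector $\mathcal F^e$, and the residuals are $r^n=\delta f_Q-A(u^n;u^n)$, $r^{n+1}=\delta f_Q-A(u^{n+1};u^{n+1})$, with $r^n\neq 0$. Let $\sigma_{01}^n=\gamma_{01}/\gamma_{10}-1$ and let $\epsilon_T>0$. Assume that the regularization parameters $\alpha^n$ and $\sigma_{01}^n$ satisfy $$\alpha^n\cdot\frac{1}{\gamma_{10}}\,\|R\mathtt{w}^n\|\le \frac{\epsilon_T}{2}\|r^n\|$$ and $$\left\|\sigma_{01}^nA(u^n;w^n)+\mathcal L^e(u^n)+\mathcal F^e\right\|\le \left\|\mathcal L^e(u^n)+\mathcal F^e\right\|.$$ Then $$\|r^{n+1}\|\le\left(1-\frac1{\gamma_{10}}\right)\|r^n\|+\frac{\epsilon_T}{2}\|r^n\|+\left\|\mathcal L^e(u^n)+\mathcal F^e\right\|.$$ Moreover, if $$\frac{\|\mathcal L^e(u^n)+\mathcal F^e\|}{\|r^n\|}<\frac{\epsilon_T}{2},$$ then the iteration converges within tolerance $\epsilon_T$ of the predicted rate $1-1/\gamma_{10}$, that is, $$\left|\frac{\|r^{n+1}\|}{\|r^n\|}-\left(1-\frac1{\gamma_{10}}\right)\right|<\epsilon_T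 .$$
   Context: Setting: $\Omega\subset\mathbb R^2$ is a polygonal domain, and $B(u;z,v)=\int_\Omega\kappa(u)\nabla z\cdot\nabla v$, where $\kappa(u)$ is a scalar or $2\times2$ matrix diffusion coefficient depending on $u$. Entrywise, $\kappa_{ij}(s)$ is bounded and Lipschitz in $s\in\mathbb R$, the uniform ellipticity condition $\sum_{i,j}\kappa_{ij}(s)\xi_i\xi_j\ge\eta|\xi|^2$ holds for some $\eta>0$, all $s\in\mathbb R$ and all $\xi\in\mathbb R^2$, and $\kappa'$ is bounded and Lipschitz. The source $f\in L_2(\Omega)$ is essentially bounded. $\mathcal V_k\subset H_0^1(\Omega)$ is a finite element space with basis $\{\varphi^j\}_{j=1}^{N}$. For $w\in\mathcal V_k$, $\mathtt w\in\mathbb R^N$ denotes its coefficient vector, $w=\sum_j\mathtt w_j\varphi^j$. $\phi(\cdot,\cdot)$ is a bilinear form, continuous in the $H^1$ norm and satisfying $\phi(w,w)\ge0$. Inexact assembly: $\mathcal A_Q$ denotes assembly with integrals replaced by an elementwise quadrature rule of the form $\int_T g\approx\sum_{i}g(x_i)\rho_i$ (interior points $x_i$, weights $\rho_i$). For $u,z,w\in\mathcal V_k$ define vectors in $\mathbb R^N$: - $A(u;z)=\mathcal A_Q\{B(u;z,\varphi^j)\}_{j=1}^N$ (linear in $z$); - $A_1'(u;z)\mathtt w=\mathcal A_Q\{\frac{d}{dt}B(u+tw;z,\varphi^j)|_{t=0}\}_{j=1}^N$, which equals $\frac{d}{dt}A(u+tw;z)|_{t=0}$; - $A_2'(u)\mathtt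 w=A(u;w)$; - $R\mathtt w$, the vector of assembled values of $\phi(w,\varphi^j)$, $j=1,\dots,N$ ($R$ is a matrix); - $f_Q=\mathcal A_Q\{\int f\varphi^j\}_{j=1}^N$. The numbers $\alpha^n,\gamma_{10},\gamma_{01},\delta$ are real regularization parameters. $w^n\in\mathcal V_k$ is the function with coefficient vector $\mathtt w^n$. Norms of vectors in $\mathbb R^N$ are Euclidean. Floating-point error: $\mathcal F^e\in\mathbb R^N$ is the defect in the solution of the linear system, defined by $$-A_1'(u^n;u^n)\mathtt w^n=\frac1{\gamma_{10}}\alpha^nR\mathtt w^n+\frac{\gamma_{01}}{\gamma_{10}}A(u^n;w^n)-\frac1{\gamma_{10}}r^n+\mathcal F^e .$$ Linearization error: $\mathcal L^e(u^n)=-K_1-K_2$, where $$K_1=A(u^{n+1};u^n)-A(u^n;u^n)-A_1'(u^n;u^n)\mathtt w^n,\qquad K_2=A(u^{n+1};w^n)-A(u^n;w^n).$$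
   Formalization: The formal theorem adds the assumption α^n ≥ 0; for negative α^n the condition on α^n‖Rw^n‖ is vacuous and the claim fails (e.g. N=1, constant κ, A=R=1, γ10=γ01=1, α^n=-2, F^e=0, ε_T=1 gives r^{n+1}=2r^n). *)

(* Defs.v *)
From HB Require Import structures.
From mathcomp Require Import all_boot all_order all_algebra.
From mathcomp Require Import all_classical all_reals all_analysis.
From mathcomp Require Import ring.

Set Implicit Arguments.
Unset Strict Implicit.
Unset Printing Implicit Defensive.

Import Order.TTheory GRing.Theory Num.Theory.
Import numFieldNormedType.Exports.

Local Open Scope classical_set_scope.
Local Open Scope ring_scope.

Definition plane (R : realType) := (R * R)%type.

Definition leb2 (R : realType) : set (plane R) -> \bar R :=
  (@lebesgue_measure R \x @lebesgue_measure R)%E.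

Definition unitvec (R : realType) (i : 'I_2) : plane R :=
  if i == ord0 then (1, 0) else (0, 1).

Definition grad (R : realType) (v : plane R -> R) (x : plane R) : 'cV[R]_2 :=
  \col_i 'D_(unitvec R i) v x.

Definition enorm (R : realType) (n : nat) (v : 'cV[R]_n) : R :=
  Num.sqrt (\sum_i v i 0 ^+ 2).

Definition hull (R : realType) (s : seq (plane R)) : set (plane R) :=
  [set x | exists c : 'I_(size s) -> R,
     [/\ forall i, 0 <= c i, \sum_i c i = 1 & x = \sum_i c i *: s`_i]].

Record polygonal_domain (R : realType) (Omega : set (plane R)) : Prop := {
  pd_open : open Omega;
  pd_connected : connected Omega;
  pd_nonempty : Omega !=set0;
  pd_bounded : bounded_set Omega;
  pd_boundary : exists s : seq (plane R * plane R),
    closure Omega `\` Omega =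
      [set x | exists2 p, p \in s & hull [:: p.1; p.2] x] }.

(* Elements are nondegenerate closed convex polygons (triangles, quadrilaterals,
   ...); hanging nodes are not excluded. *)
Record mesh_of (R : realType) (Omega : set (plane R)) (m : nat)
    (T : 'I_m -> set (plane R)) : Prop := {
  mesh_polygon : forall k, exists s, T k = hull s;
  mesh_nondegenerate : forall k, (T k)° !=set0;
  mesh_disjoint : forall k l, k != l -> (T k)° `&` (T l)° = set0;
  mesh_cover : \bigcup_k T k = closure Omega }.

Fixpoint class_C (R : realType) (n : nat) (v : plane R -> R) : Prop :=
  continuous v /\
  if n is n'.+1 then
    forall i, (forall x, derivable v x (unitvec R i)) /\
              class_C n' ('D_(unitvec R i) v)
  else True.

Definition test_function (R : realType) (Omega : set (plane R))
    (v : plane R -> R) : Prop :=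
  (forall n, class_C n v) /\
  exists K : set (plane R),
    [/\ compact K, K `<=` Omega & forall x, ~ K x -> v x = 0].

(* v belongs to the closure of the test functions in the H^1 norm, and g is its
   weak gradient on Omega. Elements of H^1_0 are represented by measurable
   functions on the plane whose values outside Omega are irrelevant. *)
Definition H10_with_grad (R : realType) (Omega : set (plane R))
    (v : plane R -> R) (g : 'I_2 -> plane R -> R) : Prop :=
  [/\ measurable_fun Omega v,
      forall i, measurable_fun Omega (g i)
    & exists psi : nat -> plane R -> R,
      [/\ forall k, test_function Omega (psi k),
          (\int[@leb2 R]_(x in Omega) ((psi k x - v x) ^+ 2)%:E)%E
            @[k --> \oo] --> 0%E
        & forall i,
          (\int[@leb2 R]_(x in Omega)
             (('D_(unitvec R i) (psi k) x - g i x) ^+ 2)%:E)%E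
            @[k --> \oo] --> 0%E]].

Definition H10 (R : realType) (Omega : set (plane R)) (v : plane R -> R) :=
  exists g, H10_with_grad Omega v g.

Definition H1norm (R : realType) (Omega : set (plane R)) (v : plane R -> R)
    (g : 'I_2 -> plane R -> R) : R :=
  Num.sqrt (fine (\int[@leb2 R]_(x in Omega) (v x ^+ 2)%:E)%E +
            \sum_i fine (\int[@leb2 R]_(x in Omega) (g i x ^+ 2)%:E)%E).

(* A scalar coefficient k is the case kappa s = (k s)%:M. *)
Record admissible_coefficient (R : realType) (eta : R) (kappa : R -> 'M[R]_2) :
    Prop := {
  kappa_bounded : forall i j, bounded_fun (fun s => kappa s i j);
  kappa_lipschitz : forall i j, lipschitz (fun s => kappa s i j);
  kappa_elliptic : forall s (xi : 'cV[R]_2),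
    eta * \sum_i xi i 0 ^+ 2 <=
      \sum_i \sum_j kappa s i j * xi i 0 * xi j 0;
  kappa_derivable : forall i j s, derivable (fun s => kappa s i j) s 1;
  kappa'_bounded : forall i j, bounded_fun (derive1 (fun s => kappa s i j));
  kappa'_lipschitz : forall i j, lipschitz (derive1 (fun s => kappa s i j)) }.

Record admissible_source (R : realType) (Omega : set (plane R))
    (f : plane R -> R) : Prop := {
  source_measurable : measurable_fun Omega f;
  source_L2 : (\int[@leb2 R]_(x in Omega) (f x ^+ 2)%:E < +oo)%E;
  source_ess_bounded : exists M : R,
    {ae @leb2 R, forall x, Omega x -> `|f x| <= M} }.

Record nonneg_H1_form (R : realType) (Omega : set (plane R))
    (phi : (plane R -> R) -> (plane R -> R) -> R) : Prop := {
  form_linear_l : forall a u v w, H10 Omega u -> H10 Omega v -> H10 Omega w ->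
    phi (fun x => a * u x + v x) w = a * phi u w + phi v w;
  form_linear_r : forall a u v w, H10 Omega u -> H10 Omega v -> H10 Omega w ->
    phi u (fun x => a * v x + w x) = a * phi u v + phi u w;
  form_continuous : exists C : R, forall v w gv gw,
    H10_with_grad Omega v gv -> H10_with_grad Omega w gw ->
    `|phi v w| <= C * H1norm Omega v gv * H1norm Omega w gw;
  form_ge0 : forall w, H10 Omega w -> 0 <= phi w w }.

Definition fe_fun (R : realType) (N : nat) (b : 'I_N -> plane R -> R)
    (c : 'cV[R]_N) : plane R -> R :=
  fun x => \sum_j c j 0 * b j x.

Definition fe_space (R : realType) (N : nat) (b : 'I_N -> plane R -> R) :
    set (plane R -> R) :=
  [set v | exists c, v = fe_fun b c].

(* b is a basis of an H^1_0-conforming finite element space. The shape functions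
   on an element need not be polynomials, only C^1 in the interior. *)
Record fe_basis (R : realType) (Omega : set (plane R)) (m : nat)
    (T : 'I_m -> set (plane R)) (N : nat) (b : 'I_N -> plane R -> R) :
    Prop := {
  fe_conforming : forall j, H10 Omega (b j);
  fe_elementwise_C1 : forall j k x i, (T k)° x ->
    derivable (b j) x (unitvec R i) /\
    {for x, continuous ('D_(unitvec R i) (b j))};
  fe_free : forall c : 'cV[R]_N,
    {ae @leb2 R, forall x, Omega x -> fe_fun b c x = 0} -> c = 0 }.

Definition B_integrand (R : realType) (kappa : R -> 'M[R]_2)
    (u z v : plane R -> R) (x : plane R) : R :=
  \sum_i (kappa (u x) *m grad z x) i 0 * grad v x i 0.

(* B itself, for reference: the discrete objects below are obtained from the
   same integrand with the integral replaced by quadrature. *)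
Definition B_form (R : realType) (Omega : set (plane R))
    (kappa : R -> 'M[R]_2) (u z v : plane R -> R) : R :=
  fine (\int[@leb2 R]_(x in Omega) (B_integrand kappa u z v x)%:E)%E.

(* A rule lists, for each element, its points with their weights. *)
Definition quad_rule (R : realType) (m : nat) := 'I_m -> seq (plane R * R).

Definition interior_rule (R : realType) (m : nat) (T : 'I_m -> set (plane R))
    (Q : quad_rule R m) : Prop :=
  forall k p, p \in Q k -> (T k)° p.1.

Definition quad (R : realType) (m : nat) (Q : quad_rule R m)
    (g : plane R -> R) : R :=
  \sum_(k < m) \sum_(p <- Q k) g p.1 * p.2.

Definition assemble (R : realType) (m : nat) (Q : quad_rule R m) (N : nat)
    (g : 'I_N -> plane R -> R) : 'cV[R]_N :=
  \col_j quad Q (g j).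

Definition A_vec (R : realType) (kappa : R -> 'M[R]_2) (m : nat)
    (Q : quad_rule R m) (N : nat) (b : 'I_N -> plane R -> R)
    (u z : plane R -> R) : 'cV[R]_N :=
  assemble Q (fun j => B_integrand kappa u z (b j)).

(* The t-derivative of B(u + t w; z, b_j) at t = 0 is the integral of the
   pointwise derivative of the integrand, which is what is assembled. *)
Definition A1'_vec (R : realType) (kappa : R -> 'M[R]_2) (m : nat)
    (Q : quad_rule R m) (N : nat) (b : 'I_N -> plane R -> R)
    (u z w : plane R -> R) : 'cV[R]_N :=
  assemble Q (fun j x =>
    derive1 (fun t => B_integrand kappa (fun y => u y + t * w y) z (b j) x) 0).

Definition A2'_vec (R : realType) (kappa : R -> 'M[R]_2) (m : nat)
    (Q : quad_rule R m) (N : nat) (b : 'I_N -> plane R -> R)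
    (u w : plane R -> R) : 'cV[R]_N :=
  A_vec kappa Q b u w.

(* The action w |-> R w of the matrix R on a coefficient vector; as phi is
   bilinear, the entries of that matrix are R_ij = phi(b_j, b_i). *)
Definition R_vec (R : realType) (N : nat) (b : 'I_N -> plane R -> R)
    (phi : (plane R -> R) -> (plane R -> R) -> R) (w : plane R -> R) :
    'cV[R]_N :=
  \col_j phi w (b j).

Definition f_vec (R : realType) (m : nat) (Q : quad_rule R m) (N : nat)
    (b : 'I_N -> plane R -> R) (f : plane R -> R) : 'cV[R]_N :=
  assemble Q (fun j x => f x * b j x).

Definition residual (R : realType) (kappa : R -> 'M[R]_2) (m : nat)
    (Q : quad_rule R m) (N : nat) (b : 'I_N -> plane R -> R)
    (f : plane R -> R) (delta : R) (u : plane R -> R) : 'cV[R]_N :=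
  delta *: f_vec Q b f - A_vec kappa Q b u u.

Definition step_operator (R : realType) (kappa : R -> 'M[R]_2) (m : nat)
    (Q : quad_rule R m) (N : nat) (b : 'I_N -> plane R -> R)
    (phi : (plane R -> R) -> (plane R -> R) -> R)
    (alpha gamma10 gamma01 : R) (u w : plane R -> R) : 'cV[R]_N :=
  alpha *: R_vec b phi w + gamma10 *: A1'_vec kappa Q b u u w
  + gamma01 *: A2'_vec kappa Q b u w.

Definition floating_point_error (R : realType) (kappa : R -> 'M[R]_2) (m : nat)
    (Q : quad_rule R m) (N : nat) (b : 'I_N -> plane R -> R)
    (phi : (plane R -> R) -> (plane R -> R) -> R)
    (alpha gamma10 gamma01 : R) (u w : plane R -> R) (r Fe : 'cV[R]_N) : Prop :=
  - A1'_vec kappa Q b u u w =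
    (gamma10^-1 * alpha) *: R_vec b phi w
    + (gamma01 / gamma10) *: A_vec kappa Q b u w
    - gamma10^-1 *: r + Fe.

Definition linearization_error (R : realType) (kappa : R -> 'M[R]_2) (m : nat)
    (Q : quad_rule R m) (N : nat) (b : 'I_N -> plane R -> R)
    (u u1 w : plane R -> R) : 'cV[R]_N :=
  let K1 := A_vec kappa Q b u1 u - A_vec kappa Q b u u
            - A1'_vec kappa Q b u u w in
  let K2 := A_vec kappa Q b u1 w - A_vec kappa Q b u w in
  - K1 - K2.

(* The error is the defect, scaled by 1/gamma10, with which w solves the
   regularized linear system. *)
Lemma floating_point_error_defect (R : realType) (kappa : R -> 'M[R]_2)
    (m : nat) (Q : quad_rule R m) (N : nat) (b : 'I_N -> plane R -> R)
    (phi : (plane R -> R) -> (plane R -> R) -> R)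
    (alpha gamma10 gamma01 : R) (u w : plane R -> R) (r Fe : 'cV[R]_N) :
  gamma10 != 0 ->
  floating_point_error kappa Q b phi alpha gamma10 gamma01 u w r Fe <->
  step_operator kappa Q b phi alpha gamma10 gamma01 u w = r - gamma10 *: Fe.
Proof.
move=> g0; rewrite /floating_point_error /step_operator /A2'_vec.
move: (R_vec _ _ _) (A1'_vec _ _ _ _ _ _) (A_vec _ _ _ _ _) => X Y Z.
split=> [h|h].
  have -> : Y = - (- Y) by rewrite opprK.
  rewrite {}h; apply/matrixP=> i j; rewrite !mxE; field.
  exact: g0.
have -> : Fe = gamma10^-1 *: (r - (r - gamma10 *: Fe)).
  by rewrite opprB addrC subrK scalerA mulVf // scale1r.
rewrite -{}h; apply/matrixP=> i j; rewrite !mxE; field.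
exact: g0.
Qed.

(* Main.v *)
Require Import Defs.
From HB Require Import structures.
From mathcomp Require Import all_boot all_order all_algebra.
From mathcomp Require Import all_classical all_reals all_analysis.
From mathcomp Require Import ring lra.

Set Implicit Arguments.
Unset Strict Implicit.
Unset Printing Implicit Defensive.

Import Order.TTheory GRing.Theory Num.Theory.
Import numFieldNormedType.Exports.
Local Open Scope classical_set_scope.
Local Open Scope ring_scope.

(** Everything rests on an exact formula for the new residual:
      r1 = (1 - 1/gamma10) r + e,
      e = (alpha/gamma10) R w + sigma A(u;w) + Le + Fe.
    As A(u1; z) is linear in z and u1 = u + w, splitting
    A(u1;u1) = A(u1;u) + A(u1;w) makes the two linearization defects K1 and K2
    appear, so that r1 = r + Le - A1'(u;u)w - A(u;w); the definition of the
    floating point error then replaces - A1'(u;u)w, and the two multiples of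
    A(u;w) combine into the factor gamma01/gamma10 - 1 = sigma.

    The parameter choices give that the norm of e is at most
    epsT/2 times that of r plus the norm of Le + Fe. As
    0 <= 1 - 1/gamma10, the triangle inequality gives the upper bound on the
    norm of r1 and the reverse triangle inequality the matching lower bound;
    dividing by the norm of r gives the convergence rate.

    The one place where the finite element setting enters is the splitting of
    A(u1;u1): pointwise gradients are additive only where the functions are
    differentiable. Elements of the finite element space are differentiable in
    the interior of each mesh element, and the quadrature points lie there
    ([A_vec_fe_funD]). *)

(** * The Euclidean norm *)

Lemma enorm_ge0 (R : realType) (n : nat) (v : 'cV[R]_n) : 0 <= enorm v.
Proof. exact: sqrtr_ge0. Qed.

Lemma enorm_sqr (R : realType) (n : nat) (v : 'cV[R]_n) :
  enorm v ^+ 2 = \sum_i v i 0 ^+ 2.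
Proof. by rewrite sqr_sqrtr // sumr_ge0 // => i _; rewrite sqr_ge0. Qed.

Lemma enorm_eq0 (R : realType) (n : nat) (v : 'cV[R]_n) :
  (enorm v == 0) = (v == 0).
Proof.
rewrite -sqrf_eq0 enorm_sqr psumr_eq0; last by move=> i _; rewrite sqr_ge0.
apply/allP/eqP => [v0|-> i _]; last by rewrite mxE expr0n eqxx.
apply/matrixP => i j; rewrite ord1 mxE.
by have := v0 i (mem_index_enum i); rewrite sqrf_eq0 => /eqP.
Qed.

Lemma enormZ (R : realType) (n : nat) (a : R) (v : 'cV[R]_n) :
  enorm (a *: v) = `|a| * enorm v.
Proof.
rewrite /enorm -sqrtr_sqr -sqrtrM ?sqr_ge0 // mulr_sumr.
by congr Num.sqrt; apply: eq_bigr => i _; rewrite mxE exprMn.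
Qed.

(** Lagrange's identity: the difference of the two sides is half the sum of
    the squares of all the 2 x 2 minors of the two vectors. *)
Lemma cauchy_schwarz_sum (R : realDomainType) (n : nat) (a b : 'I_n -> R) :
  (\sum_i a i * b i) ^+ 2 <= (\sum_i a i ^+ 2) * (\sum_i b i ^+ 2).
Proof.
have : 0 <= \sum_i \sum_j (a i * b j - a j * b i) ^+ 2.
  by do 2![apply: sumr_ge0 => ? _]; rewrite sqr_ge0.
have -> : \sum_i \sum_j (a i * b j - a j * b i) ^+ 2
    = \sum_i \sum_j a i ^+ 2 * b j ^+ 2 + \sum_i \sum_j b i ^+ 2 * a j ^+ 2
      - \sum_i \sum_j (a i * b i) * (a j * b j) *+ 2.
  rewrite -big_split -sumrB /=.
  apply: eq_bigr => i _; rewrite -big_split -sumrB /=.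
  by apply: eq_bigr => j _; ring.
under [X in _ - X]eq_bigr do rewrite sumrMnl.
rewrite sumrMnl -!big_distrlr /= -expr2; nra.
Qed.

Lemma enormD (R : realType) (n : nat) (v w : 'cV[R]_n) :
  enorm (v + w) <= enorm v + enorm w.
Proof.
rewrite -(@ler_pXn2r _ 2) ?nnegrE ?addr_ge0 ?enorm_ge0 // enorm_sqr sqrrD !enorm_sqr.
have cs : \sum_i v i 0 * w i 0 <= enorm v * enorm w.
  apply: le_trans (ler_norm _) _.
  rewrite -(@ler_pXn2r _ 2) ?nnegrE ?mulr_ge0 ?enorm_ge0 //.
  by rewrite real_normK ?num_real // exprMn !enorm_sqr cauchy_schwarz_sum.
have -> : \sum_i (v + w) i 0 ^+ 2
    = \sum_i v i 0 ^+ 2 + (\sum_i v i 0 * w i 0) *+ 2 + \sum_i w i 0 ^+ 2.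
  by rewrite -sumrMnl -!big_split /=; apply: eq_bigr => i _; rewrite mxE sqrrD.
by rewrite lerD2r lerD2l lerMn2r cs orbT.
Qed.

Lemma ler_dist_enorm (R : realType) (n : nat) (v e : 'cV[R]_n) :
  `|enorm (v + e) - enorm v| <= enorm e.
Proof.
rewrite ler_norml; have := enormD v e.
have := enormD (v + e) (- e); rewrite addrK -scaleN1r enormZ normrN1.
lra.
Qed.

(** * Linearity of the assembled form in its second argument *)

Lemma fe_fun_derivable (R : realType) (N : nat) (b : 'I_N -> plane R -> R)
    (c : 'cV[R]_N) (x v : plane R) :
  (forall j, derivable (b j) x v) -> derivable (fe_fun b c) x v.
Proof.
move=> db; have -> : fe_fun b c = \sum_j (c j 0 \*: b j).
  by rewrite fct_sumE.
by apply: derivable_sum => j; apply: derivableZ.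
Qed.

Lemma gradD (R : realType) (v w : plane R -> R) (x : plane R) :
  (forall i, derivable v x (unitvec R i)) ->
  (forall i, derivable w x (unitvec R i)) ->
  grad (v + w) x = grad v x + grad w x.
Proof. by move=> dv dw; apply/colP => i; rewrite !mxE deriveD. Qed.

Lemma B_integrandD (R : realType) (kappa : R -> 'M[R]_2)
    (u z1 z2 v : plane R -> R) (x : plane R) :
  (forall i, derivable z1 x (unitvec R i)) ->
  (forall i, derivable z2 x (unitvec R i)) ->
  B_integrand kappa u (z1 + z2) v x
    = B_integrand kappa u z1 v x + B_integrand kappa u z2 v x.
Proof.
move=> d1 d2; rewrite /B_integrand gradD // mulmxDr -big_split /=.
by apply: eq_bigr => i _; rewrite mxE mulrDl.
Qed.

Lemma quadD (R : realType) (m : nat) (Q : quad_rule R m)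
    (g g1 g2 : plane R -> R) :
  (forall k p, p \in Q k -> g p.1 = g1 p.1 + g2 p.1) ->
  quad Q g = quad Q g1 + quad Q g2.
Proof.
move=> gE; rewrite /quad -big_split /=; apply: eq_bigr => k _.
rewrite -big_split /=; apply: eq_big_seq => p pQ.
by rewrite (gE k) // mulrDl.
Qed.

(** Gradients of finite element functions are additive at the quadrature
    points because these avoid the element boundaries, across which such
    functions may have kinks. *)
Lemma A_vec_fe_funD (R : realType) (kappa : R -> 'M[R]_2)
    (Omega : set (plane R)) (m : nat) (T : 'I_m -> set (plane R))
    (Q : quad_rule R m) (N : nat) (b : 'I_N -> plane R -> R)
    (u : plane R -> R) (c d : 'cV[R]_N) :
  interior_rule T Q -> fe_basis Omega T b ->
  A_vec kappa Q b u (fe_fun b c + fe_fun b d)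
    = A_vec kappa Q b u (fe_fun b c) + A_vec kappa Q b u (fe_fun b d).
Proof.
move=> hQ hb; apply/colP => j; rewrite !mxE; apply: quadD => k p pQ.
by apply: B_integrandD => i; apply: fe_fun_derivable => l;
  have [] := fe_elementwise_C1 hb l i (hQ k p pQ).
Qed.

(** * The residual recursion *)

(** Once A(u + w; .) splits, this is pure vector algebra: K1 and K2 absorb the
    change of the coefficient from kappa(u) to kappa(u + w), and the defect
    equation trades the remaining - A1'(u;u)w for r/gamma10 and error terms. *)
Lemma residual_recursion (R : realType) (kappa : R -> 'M[R]_2) (m : nat)
    (Q : quad_rule R m) (N : nat) (b : 'I_N -> plane R -> R)
    (f : plane R -> R) (phi : (plane R -> R) -> (plane R -> R) -> R)
    (alpha gamma10 gamma01 delta : R) (u w : plane R -> R) (Fe : 'cV[R]_N) :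
  let r := residual kappa Q b f delta u in
  A_vec kappa Q b (u + w) (u + w)
    = A_vec kappa Q b (u + w) u + A_vec kappa Q b (u + w) w ->
  floating_point_error kappa Q b phi alpha gamma10 gamma01 u w r Fe ->
  residual kappa Q b f delta (u + w)
    = (1 - gamma10^-1) *: r
      + ((alpha * gamma10^-1) *: R_vec b phi w
         + ((gamma01 / gamma10 - 1) *: A_vec kappa Q b u w
            + linearization_error kappa Q b u (u + w) w + Fe)).
Proof.
rewrite /floating_point_error /linearization_error /residual => -> /=.
move: (f_vec _ _ _) (R_vec _ _ _) (A1'_vec _ _ _ _ _ _) => F X Y.
move: (A_vec _ _ _ (u + w) u) (A_vec _ _ _ (u + w) w) => A1u A1w.
move: (A_vec _ _ _ u u) (A_vec _ _ _ u w) => Au Aw.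
move=> hFe; apply/matrixP => i j.
have := congr1 (fun M : 'cV[R]_N => M i j) hFe; rewrite !mxE.
move/(canRL opprK) => ->; ring.
Qed.

Theorem lemma3p2 (R : realType)
    (Omega : set (plane R)) (hOmega : polygonal_domain Omega)
    (eta : R) (heta : 0 < eta)
    (kappa : R -> 'M[R]_2) (hkappa : admissible_coefficient eta kappa)
    (f : plane R -> R) (hf : admissible_source Omega f)
    (phi : (plane R -> R) -> (plane R -> R) -> R)
    (hphi : nonneg_H1_form Omega phi)
    (m : nat) (T : 'I_m -> set (plane R)) (hT : mesh_of Omega T)
    (Q : quad_rule R m) (hQ : interior_rule T Q)
    (N : nat) (b : 'I_N -> plane R -> R) (hb : fe_basis Omega T b)
    (alpha gamma10 gamma01 delta sigma epsT : R)
    (halpha : 0 <= alpha) (hgamma10 : 1 <= gamma10) (hepsT : 0 < epsT)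
    (hsigma : sigma = gamma01 / gamma10 - 1)
    (u w u1 : plane R -> R) (wc : 'cV[R]_N)
    (hu : fe_space b u) (hw : w = fe_fun b wc)
    (hu1 : forall x, u1 x = u x + w x)
    (r r1 Fe Le : 'cV[R]_N)
    (hr : r = residual kappa Q b f delta u)
    (hr1 : r1 = residual kappa Q b f delta u1)
    (hr_neq0 : r != 0)
    (hFe : floating_point_error kappa Q b phi alpha gamma10 gamma01 u w r Fe)
    (hLe : Le = linearization_error kappa Q b u u1 w)
    (hreg_alpha :
       alpha * gamma10^-1 * enorm (R_vec b phi w) <= epsT / 2 * enorm r)
    (hreg_sigma :
       enorm (sigma *: A_vec kappa Q b u w + Le + Fe) <= enorm (Le + Fe)) :
  enorm r1 <=
    (1 - gamma10^-1) * enorm r + epsT / 2 * enorm r + enorm (Le + Fe)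
  /\
  (enorm (Le + Fe) / enorm r < epsT / 2 ->
   `| enorm r1 / enorm r - (1 - gamma10^-1) | < epsT).
Proof.
case: hu => uc uE; have u1E : u1 = u + w by apply/funext.
have Ainc : A_vec kappa Q b (u + w) (u + w)
    = A_vec kappa Q b (u + w) u + A_vec kappa Q b (u + w) w.
  by rewrite [in LHS]uE {2}hw uE hw; apply: A_vec_fe_funD hQ hb.
have g_gt0 : 0 < gamma10 by apply: lt_le_trans hgamma10.
have rate_ge0 : 0 <= 1 - gamma10^-1 by rewrite subr_ge0 invf_le1.
rewrite hr in hFe; have := residual_recursion Ainc hFe.
rewrite -hr -u1E -hr1 -hLe -hsigma.
set e := _ + (_ + Fe) => r1E.
have e_le : enorm e <= epsT / 2 * enorm r + enorm (Le + Fe).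
  apply: le_trans (enormD _ _) _; apply: lerD => //.
  by rewrite enormZ ger0_norm // mulr_ge0 // invr_ge0 ltW.
have := ler_dist_enorm ((1 - gamma10^-1) *: r) e.
rewrite -r1E enormZ (ger0_norm rate_ge0) => dist_le.
split=> [|small].
  by move: dist_le; rewrite ler_norml => /andP[_ h]; lra.
have r_gt0 : 0 < enorm r by rewrite lt_neqAle eq_sym enorm_eq0 hr_neq0 enorm_ge0.
rewrite ltr_pdivrMr // in small.
rewrite -(ltr_pM2r r_gt0) -[X in _ * X < _](gtr0_norm r_gt0) -normrM.
rewrite mulrBl divfK ?gt_eqF //.
apply: le_lt_trans dist_le _; lra.
Qed.
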